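(* Assume Assumption B and that the design is strongly stable with limit $p^\star$. Let $N_1=\sum_{i=1}^NK_i$, $N_0=N-N_1$, $$\widehat\sigma_0^2=\frac1{\max\{N_0,1\}}\sum_{i=1}^N(1-K_i)\big(Y_i-\widehat Y_{i-1}(0)\big)^2,\qquad \widehat\sigma_1^2=\frac1{\max\{N_1,1\}}\sum_{i=1}^NK_i\big(Y_i-\widehat Y_{i-1}(1)\big)^2,$$ $$\widehat V^{\mathrm{AIPW}}_{\mathrm{strong}}=\Big(\widehat\sigma_0\sqrt{\tfrac{p^\star}{1-p^\star}}+\widehat\sigma_1\sqrt{\tfrac{1-p^\star}{p^\star}}\Big)^2,$$ with $\widehat\sigma_\ell=\sqrt{\widehat\sigma_\ell^2}$. Then $\widehat\sigma_0^2\xrightarrow{p}\sigma_0^2$, $\widehat\sigma_1^2\xrightarrow{p}\sigma_1^2$; $\widehat V^{\mathrm{AIPW}}_{\mathrm{strong}}$ converges in probability to $\big(\sigma_0\sqrt{p^\star/(1-p^\star)}+\sigma_1\sqrt{(1-p^\star)/p^\star}\big)^2$, which is $\ge V^{\mathrm{AIPW}}_{\mathrm{strong}}:=\sigma_0^2\frac{p^\star}{1-p^\star}+\sigma_1^2\frac{1-p^\star}{p^\star}+2\sigma_{01}$ (conservative); and $\widehat V^{\mathrm{AIPW}}_{\mathrm{strong}}$ is consistent for $V^{\mathrm{AIPW}}_{\mathrm{strong}}$ when the potential outcomes satisfy generalized treatment effect homogeneity, i.e. $Y_i(1)-\bar Y_N(1)$ is proportional to $Y_i(0)-\bar Y_N(0)$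 for all $i$.
   Context: Setup. Let $(Y_i(0),Y_i(1))_{i\ge1}$ be a fixed (non-random) sequence of pairs of real numbers (potential outcomes under control and treatment). For each $N$ the experiment consists of units $1,\dots,N$. Random treatment indicators $K_1,K_2,\dots\in\{0,1\}$ are assigned sequentially and the observed outcome is $Y_i=K_iY_i(1)+(1-K_i)Y_i(0)$. Let $\mathcal F_0$ be the trivial $\sigma$-field and $\mathcal F_{i-1}=\sigma(K_1,Y_1,\dots,K_{i-1},Y_{i-1})$. A sequential design is a sequence of random variables $(p_i)_{i\ge1}$ (inclusion probabilities) such that $p_i$ is $\mathcal F_{i-1}$-measurable and $\mathbb P(K_i=1\mid\mathcal F_{i-1})=p_i$. $\bar Y_N(\ell)=\frac1N\sum_{i=1}^NY_i(\ell)$. Running estimates: $\widehat Y_0(0)=\widehat Y_0(1)=0$ and for $i\ge2$, $\widehat Y_{i-1}(0)=\frac1{i-1}\sum_{j=1}^{i-1}\frac{(1-K_j)Y_j}{1-p_j}$, $\widehat Y_{i-1}(1)=\frac1{i-1}\sum_{j=1}^{i-1}\frac{K_jY_j}{p_j}$. Strong design stability: there is a non-random $p^\star\in(0,1)$ with $p_i\xrightarrow{p}p^\star$ as $i\to\infty$. Assumption B: (a) there is $\delta\in(0,1)$ with $p_i\in[\delta,1-\delta]$ for all $i\ge1$; (b) there is $M>0$ with $|Y_i(\ell)|\le M$ for all $i\ge1$, $\ell\in\{0,1\}$; (c) for $\ell\in\{0,1\}$ the limits $\bar Y_\ell=\lim_N\bar Y_N(\ell)$, $\sigma_\ell^2=\lim_N\frac1N\sum_{i=1}^N(Y_i(\ell)-\bar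 Y_N(\ell))^2$ and $\sigma_{01}=\lim_N\frac1N\sum_{i=1}^N(Y_i(0)-\bar Y_N(0))(Y_i(1)-\bar Y_N(1))$ exist, with $\sigma_0^2,\sigma_1^2>0$; $\sigma_\ell=\sqrt{\sigma_\ell^2}$.
   Formalization: Generalized treatment effect homogeneity is taken with a nonnegative proportionality constant; with a negative constant the consistency claim fails (e.g. outcomes alternating ±1 with Y_i(1) = −Y_i(0) and p_i = 1/2: the estimator tends to 4 while V = 0). *)

(* Defs.v *)
From HB Require Import structures.
From mathcomp Require Import all_boot all_order all_algebra.
From mathcomp Require Import all_classical all_reals all_analysis.
Set Implicit Arguments. Unset Strict Implicit. Unset Printing Implicit Defensive.
Import Order.TTheory GRing.Theory Num.Theory.
Import numFieldNormedType.Exports.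
Local Open Scope classical_set_scope.
Local Open Scope ring_scope.

(* Units are indexed from 0: unit i here is unit i+1 of the paper. *)

Section Defs.
Context {R : realType} {d : measure_display} {T : measurableType d}.

Definition cvg_in_prob (P : probability T R) (X : nat -> T -> R) (c : R) :=
  forall eps : R, 0 < eps ->
    (fun n => P [set w | eps < `|X n w - c|]) @ \oo --> 0%E.

Definition barY (Y : nat -> R) (N : nat) : R :=
  (N%:R)^-1 * \sum_(i < N) Y i.

Definition fp_var (Y : nat -> R) (N : nat) : R :=
  (N%:R)^-1 * \sum_(i < N) (Y i - barY Y N) ^+ 2.

Definition fp_cov (Y0 Y1 : nat -> R) (N : nat) : R :=
  (N%:R)^-1 * \sum_(i < N) ((Y0 i - barY Y0 N) * (Y1 i - barY Y1 N)).

Definition Yobs (K : nat -> T -> R) (Y0 Y1 : nat -> R) (i : nat) (w : T) : R :=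
  K i w * Y1 i + (1 - K i w) * Y0 i.

Definition hist (K : nat -> T -> R) (Y0 Y1 : nat -> R) (i : nat) : set (set T) :=
  <<s [set A | exists j, (j < i)%N /\ exists B : set R, measurable B /\
          (A = K j @^-1` B \/ A = Yobs K Y0 Y1 j @^-1` B)] >>.

(* running IPW estimates \hat Y_{i-1}(0), \hat Y_{i-1}(1) for (0-based) unit i,
   using units j < i; equal to 0 when i = 0 (since 0^-1 = 0). *)
Definition Yhat0 (K p : nat -> T -> R) (Y0 Y1 : nat -> R) (i : nat) (w : T) : R :=
  (i%:R)^-1 * \sum_(j < i) ((1 - K j w) * Yobs K Y0 Y1 j w / (1 - p j w)).

Definition Yhat1 (K p : nat -> T -> R) (Y0 Y1 : nat -> R) (i : nat) (w : T) : R :=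
  (i%:R)^-1 * \sum_(j < i) (K j w * Yobs K Y0 Y1 j w / p j w).

Definition N1 (K : nat -> T -> R) (N : nat) (w : T) : R := \sum_(i < N) K i w.
Definition N0 (K : nat -> T -> R) (N : nat) (w : T) : R := N%:R - N1 K N w.

Definition sig0hat2 (K p : nat -> T -> R) (Y0 Y1 : nat -> R) (N : nat) (w : T) : R :=
  (Num.max (N0 K N w) 1)^-1 *
  \sum_(i < N) ((1 - K i w) * (Yobs K Y0 Y1 i w - Yhat0 K p Y0 Y1 i w) ^+ 2).

Definition sig1hat2 (K p : nat -> T -> R) (Y0 Y1 : nat -> R) (N : nat) (w : T) : R :=
  (Num.max (N1 K N w) 1)^-1 *
  \sum_(i < N) (K i w * (Yobs K Y0 Y1 i w - Yhat1 K p Y0 Y1 i w) ^+ 2).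

Definition Vhat_strong (K p : nat -> T -> R) (Y0 Y1 : nat -> R) (pstar : R)
  (N : nat) (w : T) : R :=
  (Num.sqrt (sig0hat2 K p Y0 Y1 N w) * Num.sqrt (pstar / (1 - pstar)) +
   Num.sqrt (sig1hat2 K p Y0 Y1 N w) * Num.sqrt ((1 - pstar) / pstar)) ^+ 2.

End Defs.

(* Main.v *)
(* The centred indicators K_i - p_i are bounded martingale differences, so their
   averages against bounded predictable weights vanish in L^2, hence in L^1.
   As the p_i are bounded, convergence in probability to pstar is convergence
   in L^1 and passes to Cesaro means; thus (1/N) sum K_i z_i -> pstar * lim
   (1/N) sum z_i for bounded deterministic z, and the running IPW means
   converge in L^1 to the population mean.  Replacing these running means by
   their limit costs a Cesaro mean of L^1-null terms, so
   (1/N) sum K_i (Y_i - Yhat_(i-1))^2 -> pstar * sigma^2; dividing by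
   N_1 / N -> pstar gives the treated variance.  The control arm is the same
   statement for 1 - K and 1 - p.  Conservativeness is Cauchy-Schwarz passed to
   the limit, the geometric factors satisfying a * b = 1, and homogeneity is its
   equality case. *)
Require Import Defs.
From HB Require Import structures.
From mathcomp Require Import all_boot all_order all_algebra.
From mathcomp Require Import all_classical all_reals all_analysis.
From mathcomp Require Import measurable_realfun ring lra.
Set Implicit Arguments. Unset Strict Implicit. Unset Printing Implicit Defensive.
Import Order.TTheory GRing.Theory Num.Theory.
Import numFieldNormedType.Exports.
Local Open Scope classical_set_scope.
Local Open Scope ring_scope.

(** * Expectations of bounded random variables *)

Section BoundedExpectation.
Context {R : realType} {d : measure_display} {T : measurableType d}.
Context {P : probability T R}.
Implicit Types f g : T -> R.

(** Boundedness holds everywhere, not almost surely. Under a probability it gives integrability, and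
    unlike integrability it is stable under products. *)
Definition bmeas (f : T -> R) :=
  measurable_fun setT f /\ exists C, forall w, `|f w| <= C.

Lemma bmeas_cst (c : R) : bmeas (fun=> c).
Proof. by split=> //; exists `|c|. Qed.

Lemma bmeasD f g : bmeas f -> bmeas g -> bmeas (fun w => f w + g w).
Proof.
move=> [mf [C Cf]] [mg [D Dg]]; split; first exact: measurable_funD.
by exists (C + D) => w; rewrite (le_trans (ler_normD _ _))// lerD.
Qed.

Lemma bmeasM f g : bmeas f -> bmeas g -> bmeas (fun w => f w * g w).
Proof.
move=> [mf [C Cf]] [mg [D Dg]]; split; first exact: measurable_funM.
by exists (C * D) => w; rewrite normrM ler_pM.
Qed.

Lemma bmeasB f g : bmeas f -> bmeas g -> bmeas (fun w => f w - g w).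
Proof.
move=> [mf [C Cf]] [mg [D Dg]]; split; first exact: measurable_funB.
by exists (C + D) => w; rewrite (le_trans (ler_normB _ _))// lerD.
Qed.

Lemma bmeas_norm f : bmeas f -> bmeas (fun w => `|f w|).
Proof.
move=> [mf [C Cf]]; split; first exact: measurableT_comp.
by exists C => w; rewrite normr_id.
Qed.

Lemma bmeas_sum {I : Type} (s : seq I) (f : I -> T -> R) :
  (forall i, bmeas (f i)) -> bmeas (fun w => \sum_(i <- s) f i w).
Proof.
move=> bf; elim: s => [|i s IH].
  by under eq_fun do rewrite big_nil; exact: bmeas_cst.
by under eq_fun do rewrite big_cons; exact: bmeasD.
Qed.

Lemma bmeas_indic (A : set T) : measurable A -> bmeas (\1_A : T -> R).
Proof.
move=> mA; split; first exact: measurable_indic.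
by exists 1 => w; rewrite indicE; case: (_ \in _); rewrite ?normr1 ?normr0.
Qed.

Lemma bmeas_integrable f : bmeas f -> P.-integrable setT (EFin \o f).
Proof.
move=> [mf [C Cf]]; apply: measurable_bounded_integrable => //.
  by rewrite (le_lt_trans (probability_le1 P measurableT))// ltry.
exists C; split; first exact: num_real.
by move=> x Cx w _ /=; rewrite (le_trans (Cf w))// ltW.
Qed.

Local Notation E f := (Rintegral P setT f).

Lemma E_cst (c : R) : E (fun=> c) = c.
Proof.
rewrite Rintegral_cst// (_ : fine _ = 1) ?mulr1//.
exact: (congr1 fine (probability_setT P)).
Qed.

Lemma E_D f g : bmeas f -> bmeas g -> E (fun w => f w + g w) = E f + E g.
Proof. by move=> bf bg; rewrite RintegralD//; exact: bmeas_integrable. Qed.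

Lemma E_B f g : bmeas f -> bmeas g -> E (fun w => f w - g w) = E f - E g.
Proof. by move=> bf bg; rewrite RintegralB//; exact: bmeas_integrable. Qed.

Lemma E_Z (c : R) f : bmeas f -> E (fun w => c * f w) = c * E f.
Proof. by move=> bf; rewrite RintegralZl//; exact: bmeas_integrable. Qed.

Lemma E_le f g : bmeas f -> bmeas g -> (forall w, f w <= g w) -> E f <= E g.
Proof. by move=> bf bg fg; apply: le_Rintegral => //; exact: bmeas_integrable. Qed.

Lemma E_ge0 f : (forall w, 0 <= f w) -> 0 <= E f.
Proof. by move=> f0; apply: Rintegral_ge0. Qed.

Lemma E_norm f : bmeas f -> `|E f| <= E (fun w => `|f w|).
Proof. by move=> bf; apply: le_normr_Rintegral => //; exact: bmeas_integrable. Qed.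

Lemma E_sum {I : Type} (s : seq I) (f : I -> T -> R) :
  (forall i, bmeas (f i)) ->
  E (fun w => \sum_(i <- s) f i w) = \sum_(i <- s) E (f i).
Proof.
move=> bf; elim: s => [|i s IH].
  by under eq_fun do rewrite big_nil; rewrite big_nil E_cst.
under eq_fun do rewrite big_cons.
by rewrite big_cons E_D ?IH//; exact: bmeas_sum.
Qed.

Lemma eq_E f g : f =1 g -> E f = E g.
Proof. by move=> /funext ->. Qed.

Lemma E_indic (A : set T) : measurable A -> (E (\1_A))%:E = P A.
Proof.
move=> mA; rewrite /Rintegral integral_indic// setIT fineK//.
exact: fin_num_measure.
Qed.

End BoundedExpectation.

(** The sum counts the positive integers up to [x], so it is the integer part of [x]; this controls
    the step approximations of bounded weights. *)
Lemma layer_cake_error (R : realDomainType) (x : R) (L : nat) : 0 <= x <= L%:R ->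
  `|x - \sum_(k < L) (k.+1%:R <= x)%R%:R| <= 1.
Proof.
move=> /andP[x0]; elim: L => [|L IH] xL.
  by rewrite big_ord0 subr0 ger0_norm// (le_trans xL).
have [xL'|Lx] := leP x L%:R.
  rewrite big_ord_recr/= (lt_geF (le_lt_trans xL' _)) ?ltr_nat//= addr0.
  exact: IH.
rewrite big_ord_recr/=.
rewrite (eq_bigr (fun=> 1)); last first.
  by move=> i _; rewrite (le_trans _ (ltW Lx))// ler_nat.
rewrite sumr_const card_ord ler_norml.
move: xL Lx; rewrite -natr1.
by case: (leP (L%:R + 1) x) => /= ? ? ?; apply/andP; split; lra.
Qed.

(** * Martingale differences *)

Section MartingaleDifferences.
Context {R : realType} {d : measure_display} {T : measurableType d}.
Context (P : probability T R).
Local Notation E f := (Rintegral P setT f).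

(** Measurability for a sub-sigma-field given by generators: the domain is retyped so that its
    canonical sigma-algebra is [<<s G >>]. *)
Definition gmeas (G : set (set T)) (f : T -> R) :=
  measurable_fun [set: g_sigma_algebraType G] (f : g_sigma_algebraType G -> R).

Lemma gmeas_cst G (c : R) : gmeas G (fun=> c).
Proof. exact: measurable_cst. Qed.

Lemma gmeasD G f g : gmeas G f -> gmeas G g -> gmeas G (fun w => f w + g w).
Proof. exact: measurable_funD. Qed.

Lemma gmeasB G f g : gmeas G f -> gmeas G g -> gmeas G (fun w => f w - g w).
Proof. exact: measurable_funB. Qed.

Lemma gmeasM G f g : gmeas G f -> gmeas G g -> gmeas G (fun w => f w * g w).
Proof. exact: measurable_funM. Qed.

Lemma gmeasS (G H : set (set T)) f :
  <<s G >> `<=` <<s H >> -> gmeas G f -> gmeas H f.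
Proof. by move=> GH mf _ B mB; apply: GH; exact: (mf measurableT). Qed.

Lemma gmeas_meas (G : set (set T)) f :
  <<s G >> `<=` measurable -> gmeas G f -> measurable_fun setT f.
Proof. by move=> GH mf _ B mB; apply: GH; exact: (mf measurableT). Qed.

(* The bounded weight [g] is a uniform limit of step functions
   [n^-1 * \sum_k 1_{k+1 <= n (g + B)}], each step set lying in [<<s G >>]. *)
Lemma E_orthogonal (G : set (set T)) (f g : T -> R) :
  <<s G >> `<=` measurable -> bmeas f ->
  (forall A, <<s G >> A -> E (fun w => \1_A w * f w) = 0) ->
  gmeas G g -> (exists B, forall w, `|g w| <= B) ->
  E (fun w => g w * f w) = 0.
Proof.
move=> Gm bf f0 mg [B gB].
have B0 : 0 <= B by rewrite (le_trans _ (gB point)).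
have [C fC] := bf.2.
have bg : bmeas g by split; [exact: gmeas_meas mg|exists B].
have Ef0 : E f = 0.
  rewrite -[RHS](f0 setT); last exact: (@measurableT _ (g_sigma_algebraType G)).
  by apply: eq_E => w; rewrite indicT mul1r.
(* The index [n] is the resolution of the step approximation; letting it grow forces the expectation
   to vanish. *)
suff H n : `|E (fun w => g w * f w)| <= C / n.+1%:R.
  apply/eqP; rewrite -normr_eq0 eq_le normr_ge0 andbT.
  apply/ler_addgt0Pr => e e0; rewrite add0r.
  have C0 : 0 <= C by rewrite (le_trans _ (fC point)).
  have := H (Num.truncn (C / e)); move=> /le_trans; apply.
  rewrite ler_pdivrMr// mulrC -ler_pdivrMr//.
  by apply: ltW; rewrite -truncn_le_nat.
(* Since [g + B] lies between 0 and [2B], the rescaled [h] lies between 0 and [L], so [L] unit steps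
   suffice. *)
pose h w := n.+1%:R * (g w + B).
pose L := (Num.truncn (n.+1%:R * (B + B))).+1.
pose A (k : nat) := [set w | k.+1%:R <= h w].
have mA k : <<s G >> (A k).
  have mh : gmeas G h.
    by apply: gmeasM; [exact: gmeas_cst|apply: gmeasD => //; exact: gmeas_cst].
  have := mh measurableT `[k.+1%:R, +oo[%classic (measurable_itv _).
  rewrite setTI; congr (<<s G >> _); apply/seteqP; split => w /=;
    by rewrite /A/= in_itv/= andbT.
pose s w := \sum_(k < L) \1_(A k) w * f w.
have bAf k : bmeas (fun w => \1_(A k) w * f w).
  by apply: bmeasM => //; apply: bmeas_indic; exact: Gm.
have bs : bmeas s by exact: bmeas_sum.
have Es : E s = 0.
  by rewrite E_sum// big1// => k _; exact: f0.
have bgf : bmeas (fun w => g w * f w) by exact: bmeasM.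
have bBf : bmeas (fun w => B * f w) by apply: bmeasM => //; exact: bmeas_cst.
(* Both correction terms have mean zero: [E f = 0] handles the shift by [B], and [E s = 0] the step
   function. *)
have -> : E (fun w => g w * f w) =
    E (fun w => (g w * f w + B * f w) - n.+1%:R^-1 * s w).
  rewrite E_B ?E_D ?E_Z// ?Es ?Ef0 ?mulr0 ?subr0 ?addr0//.
    exact: bmeasD.
  by apply: bmeasM => //; exact: bmeas_cst.
have bt : bmeas (fun w => (g w * f w + B * f w) - n.+1%:R^-1 * s w).
  by apply: bmeasB; [exact: bmeasD|apply: bmeasM => //; exact: bmeas_cst].
rewrite (le_trans (E_norm bt))//.
rewrite -[leRHS](@E_cst _ _ _ P); apply: E_le.
- exact: bmeas_norm.
- exact: bmeas_cst.
move=> w; rewrite /s -mulr_suml -mulrDl mulrA -mulrBl normrM mulrC ler_pM//.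
have -> : g w + B = n.+1%:R^-1 * h w by rewrite /h mulKf.
rewrite -mulrBr normrM ger0_norm ?invr_ge0// -[leRHS]mulr1 ler_wpM2l ?invr_ge0//.
have -> : \sum_(k < L) (\1_(A k) w : R) = \sum_(k < L) (k.+1%:R <= h w)%R%:R.
  apply: eq_bigr => k _; rewrite indicE; congr (_%:R); congr nat_of_bool.
  by apply/idP/idP; rewrite inE.
apply: layer_cake_error; apply/andP; split.
  rewrite /h mulr_ge0//; have := gB w; rewrite ler_norml; lra.
apply: ltW; rewrite /L -truncn_le_nat.
apply: le_truncn; rewrite ler_wpM2l// lerD2r.
by have := gB w; rewrite ler_norml => /andP[].
Qed.

Lemma gmeas_sum G (n : nat) (f : nat -> T -> R) :
  (forall i, (i < n)%N -> gmeas G (f i)) ->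
  gmeas G (fun w => \sum_(i < n) f i w).
Proof.
elim: n => [_|n IH Hf].
  by under eq_fun do rewrite big_ord0; exact: gmeas_cst.
under eq_fun do rewrite big_ord_recr/=.
apply: gmeasD; last exact: Hf.
by apply: IH => i ni; apply: Hf; rewrite ltnS ltnW.
Qed.

Definition filtration (G : nat -> set (set T)) :=
  (forall i, <<s G i >> `<=` measurable) /\
  (forall i, <<s G i >> `<=` <<s G i.+1 >>).

Lemma filtration_le G i j : filtration G -> (i <= j)%N ->
  <<s G i >> `<=` <<s G j >>.
Proof.
move=> [_ GS]; elim: j => [|j IH]; first by rewrite leqn0 => /eqP ->.
rewrite leq_eqVlt => /orP[/eqP -> //|]; rewrite ltnS => /IH H.
exact: subset_trans (GS j).
Qed.

(** [G i] is the information before step [i]. The last clause expresses that the conditional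
    expectation of [X i] given [G i] is zero, by integrating over the sets of [<<s G i >>]. *)
Definition mdiff (G : nat -> set (set T)) (X : nat -> T -> R) (C : R) :=
  [/\ forall i, gmeas (G i.+1) (X i), forall i w, `|X i w| <= C &
      forall i A, <<s G i >> A -> E (fun w => \1_A w * X i w) = 0].

Section Theory.
Context (G : nat -> set (set T)) (X : nat -> T -> R) (C : R).
Context (fG : filtration G) (mX : mdiff G X C).

Lemma mdiff_bmeas i : bmeas (X i).
Proof.
have [mX1 bX _] := mX.
by split; [exact: gmeas_meas (fG.1 _) (mX1 i)|exists C].
Qed.

(** A bounded martingale transform: [\1_A * h i] is again a bounded weight known at stage [i], hence
    orthogonal to [X i]. *)
Lemma mdiff_mul (h : nat -> T -> R) (B : R) :
  (forall i, gmeas (G i) (h i)) -> (forall i w, `|h i w| <= B) ->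
  mdiff G (fun i w => h i w * X i w) (B * C).
Proof.
move=> mh bh; have [mX1 bX oX] := mX; split=> [i|i w|i A GA].
- by apply: gmeasM => //; exact: gmeasS (fG.2 _) (mh i).
- by rewrite normrM ler_pM.
have -> : (fun w => \1_A w * (h i w * X i w)) =
    (fun w => (\1_A w * h i w) * X i w).
  by apply/funext => w; rewrite mulrA.
apply: (E_orthogonal (fG.1 i) (mdiff_bmeas i) (oX i)).
  apply: gmeasM => //.
  exact: (@measurable_indic _ (g_sigma_algebraType (G i)) R setT A GA).
exists B => w; rewrite normrM -[leRHS]mul1r ler_pM//.
by rewrite indicE; case: (_ \in _); rewrite ?normr1 ?normr0.
Qed.

(** Martingale differences are orthogonal: the partial sum is known at stage [n], so its product
    with [X n] has mean zero and only the squares, each at most [C ^+ 2], accumulate. *)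
Lemma mdiff_sqr_sum n :
  E (fun w => (\sum_(i < n) X i w) ^+ 2) <= n%:R * C ^+ 2.
Proof.
have [mX1 bX oX] := mX.
have C0 : 0 <= C by rewrite (le_trans _ (bX 0 point)).
pose S n w := \sum_(i < n) X i w.
have bS m : bmeas (S m) by apply: bmeas_sum => i; exact: mdiff_bmeas.
elim: n => [|n IH].
  under eq_fun do rewrite big_ord0 expr0n.
  by rewrite E_cst mul0r.
have mS : gmeas (G n) (S n).
  apply: gmeas_sum => i ltin; apply: gmeasS (mX1 i).
  exact: filtration_le.
have bX2 : bmeas (fun w => X n w ^+ 2).
  by under eq_fun do rewrite expr2; apply: bmeasM; exact: mdiff_bmeas.
have bS2 : bmeas (fun w => S n w ^+ 2).
  by under eq_fun do rewrite expr2; exact: bmeasM.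
have bSX : bmeas (fun w => S n w * X n w).
  by apply: bmeasM => //; exact: mdiff_bmeas.
have -> : (fun w => (\sum_(i < n.+1) X i w) ^+ 2) =
    (fun w => (S n w ^+ 2 + X n w ^+ 2) + 2 * (S n w * X n w)).
  by apply/funext => w; rewrite big_ord_recr/= -/(S n w); ring.
rewrite E_D; [|exact: bmeasD|by apply: bmeasM => //; exact: bmeas_cst].
rewrite E_D// E_Z// (E_orthogonal (fG.1 n) (mdiff_bmeas n) (oX n) mS); last first.
  by have [_ [B SB]] := bS n; exists B.
rewrite mulr0 addr0 -natr1 mulrDl mul1r lerD//.
rewrite -[leRHS](@E_cst _ _ _ P); apply: E_le => //; first exact: bmeas_cst.
by move=> w; rewrite -real_normK ?num_real// lerXn2r ?nnegrE.
Qed.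

(** The second moment of the mean is at most [C ^+ 2 / n], which tends to 0. *)
Lemma mdiff_mean_L1 :
  (fun n => E (fun w => `|n%:R^-1 * \sum_(i < n) X i w|)) @ \oo --> 0.
Proof.
apply/cvgr0Pnorm_le => e e0; near=> n.
have n0 : 0 < n%:R :> R by rewrite ltr0n; near: n; exact: nbhs_infty_gt.
have e20 : 0 < e / 2 by rewrite divr_gt0.
set S := fun w => \sum_(i < n) X i w.
have bS : bmeas S by apply: bmeas_sum => i; exact: mdiff_bmeas.
have bS2 : bmeas (fun w => S w ^+ 2).
  by under eq_fun do rewrite expr2; exact: bmeasM.
rewrite ger0_norm; last exact: E_ge0.
(* [|x| <= a + x^2 / a] turns the second moment bound into an L1 bound *)
pose k := (e / 2)^-1 * n%:R ^- 2.
have bk : bmeas (fun w => k * S w ^+ 2) by apply: bmeasM => //; exact: bmeas_cst.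
apply: (@le_trans _ _ (E (fun w => e / 2 + k * S w ^+ 2))).
  apply: E_le.
  - by apply: bmeas_norm; apply: bmeasM; [exact: bmeas_cst|].
  - by apply: bmeasD => //; exact: bmeas_cst.
  move=> w; have -> : k * S w ^+ 2 = (e / 2)^-1 * `|n%:R^-1 * S w| ^+ 2.
    by rewrite real_normK ?num_real// exprMn exprVn -mulrA.
  have := normr_ge0 (n%:R^-1 * S w); set x := `|_|; move: e20.
  set a := e / 2 => a0 x0.
  have [xa|ax] := leP x a.
    by rewrite (le_trans xa)// lerDl mulr_ge0// ?invr_ge0 ?exprn_ge0// ltW.
  apply: (@le_trans _ _ (a^-1 * x ^+ 2)); last by rewrite lerDr ltW.
  by rewrite ler_pdivlMl// expr2 ler_wpM2r// ltW.
rewrite E_D ?E_cst ?E_Z//; last exact: bmeas_cst.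
rewrite [leRHS]splitr lerD2l.
apply: (@le_trans _ _ (k * (n%:R * C ^+ 2))).
  rewrite ler_wpM2l ?mdiff_sqr_sum// /k mulr_ge0 ?invr_ge0 ?exprn_ge0//.
  exact: ltW.
have -> : k * (n%:R * C ^+ 2) = (e / 2)^-1 * (C ^+ 2 / n%:R).
  by rewrite /k; field; rewrite gt_eqF// gt_eqF.
rewrite ler_pdivrMl// ler_pdivrMr// mulrC -ler_pdivrMr ?mulr_gt0//.
by near: n; exact: nbhs_infty_ger.
Unshelve. all: by end_near. Qed.

End Theory.
End MartingaleDifferences.

(** * Convergence in mean and in probability *)

(** Cesaro's theorem averages the first [n + 1] terms; a shift of index gives the present form. *)
Lemma cvg_mean (R : realType) (u : nat -> R) (l : R) : u @ \oo --> l ->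
  (fun n => n%:R^-1 * \sum_(i < n) u i) @ \oo --> l.
Proof.
move=> /cesaro ul; rewrite -cvg_shiftS /=.
apply: cvg_trans ul; apply: near_eq_cvg; near=> n.
by rewrite /arithmetic_mean /series/= big_mkord.
Unshelve. all: by end_near. Qed.

Section ConvergenceInMean.
Context {R : realType} {d : measure_display} {T : measurableType d}.
Context (P : probability T R).
Local Notation E f := (Rintegral P setT f).
Implicit Types (X Y Z : nat -> T -> R).

Lemma measurable_dev (f : T -> R) (c eps : R) : measurable_fun setT f ->
  measurable [set w | eps < `|f w - c|].
Proof.
move=> mf.
have m : measurable_fun setT (fun w => `|f w - c|).
  by apply: measurableT_comp => //; exact: measurable_funB.
have := m measurableT `]eps, +oo[%classic (measurable_itv _).
by rewrite setTI; congr measurable; apply/seteqP; split => w /=;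
  rewrite in_itv/= andbT.
Qed.

Lemma cvg_in_probP X c : (forall n, measurable_fun setT (X n)) ->
  cvg_in_prob P X c <->
  forall eps, 0 < eps ->
    (fun n => E \1_[set w | eps < `|X n w - c|]) @ \oo --> 0.
Proof.
move=> mX.
have H eps : (fun n => P [set w | eps < `|X n w - c|]) =
    EFin \o (fun n => E \1_[set w | eps < `|X n w - c|]).
  by apply/funext => n /=; rewrite E_indic//; exact: measurable_dev.
split=> h eps /h.
  by rewrite H => /fine_cvgP[_].
by rewrite H => h'; apply/fine_cvgP; split => //; exact: nearW.
Qed.

(** Each [X n] is bounded, with a bound that may depend on [n]; this keeps every expectation below
    finite. *)
Definition cvgL1 X (c : R) :=
  (forall n, bmeas (X n)) /\ (fun n => E (fun w => `|X n w - c|)) @ \oo --> 0.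

Lemma cvgL1_bmeas_dev X c n : cvgL1 X c -> bmeas (fun w => `|X n w - c|).
Proof.
by move=> [bX _]; apply: bmeas_norm; apply: bmeasB => //; exact: bmeas_cst.
Qed.

Lemma cvgL1_squeeze X c (u : nat -> R) : (forall n, bmeas (X n)) ->
  (forall n, E (fun w => `|X n w - c|) <= u n) -> u @ \oo --> 0 -> cvgL1 X c.
Proof.
move=> bX Xu u0; split => //; apply: squeeze_cvgr (cvg_cst 0) u0.
by near=> n; rewrite Xu E_ge0.
Unshelve. all: by end_near. Qed.

Lemma cvgL1_dom X Y c e (K : R) : (forall n, bmeas (Y n)) ->
  (forall n w, `|Y n w - e| <= K * `|X n w - c|) -> cvgL1 X c -> cvgL1 Y e.
Proof.
move=> bY XY cX.
apply: (@cvgL1_squeeze _ _ (fun n => K * E (fun w => `|X n w - c|))) => // [n|].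
  rewrite -E_Z; last exact: cvgL1_bmeas_dev.
  apply: E_le; last exact: XY.
    by apply: bmeas_norm; apply: bmeasB => //; exact: bmeas_cst.
  by apply: bmeasM; [exact: bmeas_cst|exact: cvgL1_bmeas_dev].
by rewrite -[X in _ --> X](mulr0 K); apply: cvgMr; exact: cX.2.
Qed.

Lemma cvgL1_cst (u : nat -> R) (c : R) :
  u @ \oo --> c -> cvgL1 (fun n _ => u n) c.
Proof.
move=> uc; split; first by move=> n; exact: bmeas_cst.
under eq_fun do rewrite E_cst.
by apply/norm_cvg0P; apply/subr_cvg0.
Qed.

Lemma cvgL1D X Y c e : cvgL1 X c -> cvgL1 Y e ->
  cvgL1 (fun n w => X n w + Y n w) (c + e).
Proof.
move=> cX cY.
apply: (@cvgL1_squeeze _ _ (fun n => E (fun w => `|X n w - c|) +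
   E (fun w => `|Y n w - e|))).
- by move=> n; apply: bmeasD; [exact: cX.1|exact: cY.1].
- move=> n; rewrite -E_D; [|exact: cvgL1_bmeas_dev|exact: cvgL1_bmeas_dev].
  apply: E_le.
  + apply: bmeas_norm; apply: bmeasB; last exact: bmeas_cst.
    by apply: bmeasD; [exact: cX.1|exact: cY.1].
  + by apply: bmeasD; exact: cvgL1_bmeas_dev.
  by move=> w; rewrite opprD addrACA ler_normD.
by rewrite -[X in _ --> X](addr0 0); apply: cvgD; [exact: cX.2|exact: cY.2].
Qed.

(** By the triangle inequality the L1 norm of the mean is at most the mean of the L1 norms, a Cesaro
    mean of a null sequence. *)
Lemma cvgL1_mean X c : cvgL1 X c ->
  cvgL1 (fun n w => n%:R^-1 * \sum_(i < n) (X i w - c)) 0.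
Proof.
move=> cX; have bXc i : bmeas (fun w => X i w - c).
  by apply: bmeasB; [exact: cX.1|exact: bmeas_cst].
apply: (@cvgL1_squeeze _ _ (fun n => n%:R^-1 *
    \sum_(i < n) E (fun w => `|X i w - c|))).
- by move=> n; apply: bmeasM; [exact: bmeas_cst|exact: bmeas_sum].
- move=> n; rewrite -E_sum; last by move=> i; exact: cvgL1_bmeas_dev.
  rewrite -E_Z; last by apply: bmeas_sum => i; exact: cvgL1_bmeas_dev.
  apply: E_le.
  + apply: bmeas_norm; apply: bmeasB; last exact: bmeas_cst.
    by apply: bmeasM; [exact: bmeas_cst|exact: bmeas_sum].
  + apply: bmeasM; first exact: bmeas_cst.
    by apply: bmeas_sum => i; exact: cvgL1_bmeas_dev.
  move=> w; rewrite subr0 normrM ger0_norm ?invr_ge0// ler_wpM2l ?invr_ge0//.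
  exact: ler_norm_sum.
exact: cvg_mean cX.2.
Qed.

(** Markov's inequality. *)
Lemma cvgL1_prob X c : cvgL1 X c -> cvg_in_prob P X c.
Proof.
move=> cX; have [bX cX'] := cX.
have mX n : measurable_fun setT (X n) by exact: (bX n).1.
apply/cvg_in_probP => // eps e0.
apply: (@squeeze_cvgr _ _ _ _ (cst 0)
    (fun n => eps^-1 * E (fun w => `|X n w - c|))); last 2 first.
- exact: cvg_cst.
- by rewrite -[X in _ --> X](mulr0 eps^-1); exact: cvgMr.
near=> n; apply/andP; split.
  by apply: E_ge0 => w; rewrite indicE.
have m := @measurable_dev (X n) c eps (mX n).
rewrite -E_Z; last exact: cvgL1_bmeas_dev.
apply: E_le => [||w]; first exact: bmeas_indic.
  by apply: bmeasM; [exact: bmeas_cst|exact: cvgL1_bmeas_dev].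
rewrite ler_pdivlMl// indicE; case: (boolP (_ \in _)) => [|_].
  by rewrite inE/= mulr1 => /ltW.
by rewrite mulr0.
Unshelve. all: by end_near. Qed.

(** Bounded convergence: the deviation is at most [e / 2] off the event [A n], and at most [C + |c|]
    on it, where the probability vanishes. *)
Lemma cvg_in_prob_L1 X c (C : R) : (forall n, measurable_fun setT (X n)) ->
  (forall n w, `|X n w| <= C) -> cvg_in_prob P X c -> cvgL1 X c.
Proof.
move=> mX XC pX.
have bX n : bmeas (X n) by split => //; exists C.
have b n : bmeas (fun w => `|X n w - c|).
  by apply: bmeas_norm; apply: bmeasB => //; exact: bmeas_cst.
split => //; apply/cvgr0Pnorm_le => e e0.
have e20 : 0 < e / 2 by rewrite divr_gt0.
have C0 : 0 <= C + `|c| by rewrite addr_ge0// (le_trans _ (XC 0 point)).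
pose A n := [set w | e / 2 < `|X n w - c|].
have mA n : measurable (A n) by exact: measurable_dev.
have A0 : (fun n => E \1_(A n)) @ \oo --> 0 := (cvg_in_probP c mX).1 pX _ e20.
have : (fun n => (C + `|c|) * E \1_(A n)) @ \oo --> 0.
  by rewrite -[X in _ --> X](mulr0 (C + `|c|)); exact: cvgMr.
move=> /cvgr0Pnorm_le/(_ _ e20) h; near=> n.
rewrite ger0_norm; last exact: E_ge0.
have bA : bmeas (fun w => (C + `|c|) * \1_(A n) w).
  by apply: bmeasM; [exact: bmeas_cst|exact: bmeas_indic].
apply: (@le_trans _ _ (E (fun w => e / 2 + (C + `|c|) * \1_(A n) w))).
  apply: E_le => // [|w]; first by apply: bmeasD => //; exact: bmeas_cst.
  rewrite indicE; case: (boolP (_ \in _)) => [_|].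
    rewrite mulr1 (le_trans (ler_normB _ _))//.
    by apply: ler_wpDl; [exact: ltW|rewrite lerD].
  by rewrite notin_setE /A/= => /negP; rewrite -leNgt mulr0 addr0.
rewrite E_D ?E_cst ?E_Z//; [|exact: bmeas_indic|exact: bmeas_cst].
rewrite [leRHS]splitr lerD2l.
by apply: (le_trans (ler_norm _)); near: n.
Unshelve. all: by end_near. Qed.

(* Continuous mapping; the identity [Z = f (X, Y)] is only needed eventually
   and where [X] is close to its limit. *)
Lemma cvg_in_prob_map2 X Y Z (f : R * R -> R) (c e r : R) :
  (forall n, measurable_fun setT (X n)) -> (forall n, measurable_fun setT (Y n)) ->
  (forall n, measurable_fun setT (Z n)) -> {for (c, e), continuous f} ->
  0 < r ->
  (\forall n \near \oo, forall w, `|X n w - c| <= r ->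
     Z n w = f (X n w, Y n w)) ->
  cvg_in_prob P X c -> cvg_in_prob P Y e -> cvg_in_prob P Z (f (c, e)).
Proof.
move=> mX mY mZ cf r0 Zf pX pY.
apply/cvg_in_probP => // eps e0.
have /cvgrPdist_le/(_ _ e0) := cf.
move=> /nbhs_ballP[del /= del0 fdel].
(* Within [r] the identity for [Z] applies; half of [del] gives the strict inequality that
   membership in the ball requires. *)
pose s := Num.min r (del / 2).
have s0 : 0 < s by rewrite lt_min r0 divr_gt0.
have X0 := (cvg_in_probP c mX).1 pX _ s0.
have Y0 := (cvg_in_probP e mY).1 pY _ s0.
(* Union bound: for large [n], [Z n] can be far from its limit only where [X n] or [Y n] deviates by
   more than [s]. *)
apply: (@squeeze_cvgr _ _ _ _ (cst 0)
    (fun n => E \1_[set w | s < `|X n w - c|] +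
              E \1_[set w | s < `|Y n w - e|])); last 2 first.
- exact: cvg_cst.
- by rewrite -[X in _ --> X](addr0 0); apply: cvgD; [exact: X0|exact: Y0].
near=> n; apply/andP; split.
  by apply: E_ge0 => w; rewrite indicE.
have bX := bmeas_indic (measurable_dev c s (mX n)).
have bY := bmeas_indic (measurable_dev e s (mY n)).
rewrite -E_D//; apply: E_le.
- by apply: bmeas_indic; exact: measurable_dev.
- exact: bmeasD.
move=> w; rewrite !indicE; case: (boolP (w \in [set w | eps < _])); last first.
  by rewrite addr_ge0.
rewrite inE /= => dZ.
have [Xs|Xs] := ltP s `|X n w - c|.
  by rewrite (mem_set (Xs : [set w | s < `|X n w - c|] w)) lerDl.
have [Ys|Ys] := ltP s `|Y n w - e|.
  by rewrite (mem_set (Ys : [set w | s < `|Y n w - e|] w)) lerDr.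
exfalso; move: dZ; apply/negP; rewrite -leNgt.
have -> : Z n w = f (X n w, Y n w).
  move: w Xs {Ys} => w Xs; have : s <= r by rewrite ge_min lexx.
  by move=> /(le_trans Xs); move: w {Xs}; near: n.
have sd : s < del.
  by rewrite gt_min [del / 2 < _]gtr_pMr// ?invf_lt1 ?ltr1n ?orbT.
rewrite distrC; apply: fdel; split; rewrite /= /ball/= distrC.
  exact: le_lt_trans sd.
exact: le_lt_trans sd.
Unshelve. all: by end_near. Qed.

End ConvergenceInMean.

(** * Inverse probability weighted means and variances *)

(** Recentring from the mean at [n] to the limit mean adds exactly [(barY y n - ybar) ^+ 2], which
    vanishes; the cross term is zero because deviations from their own mean sum to zero. *)
Lemma cvg_mean_sqr_dev (R : realType) (y : nat -> R) (ybar s2 : R) :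
  barY y @ \oo --> ybar -> fp_var y @ \oo --> s2 ->
  (fun n => n%:R^-1 * \sum_(i < n) (y i - ybar) ^+ 2) @ \oo --> s2.
Proof.
move=> yb vs.
have : (fun n => fp_var y n + (barY y n - ybar) ^+ 2) @ \oo --> s2.
  rewrite -[X in _ --> X]addr0; apply: cvgD => //.
  have h : (fun n => barY y n - ybar) @ \oo --> 0 by exact/subr_cvg0.
  by rewrite -[X in _ --> X](mulr0 0); exact: cvgM.
apply: cvg_trans; apply: near_eq_cvg; near=> n.
have n0 : n%:R != 0 :> R.
  by rewrite pnatr_eq0 -lt0n; near: n; exact: nbhs_infty_gt.
rewrite /fp_var; set b := barY y n.
have yE : \sum_(i < n) y i = n%:R * b by rewrite /b /barY mulVKf.
have -> : \sum_(i < n) (y i - ybar) ^+ 2 =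
   \sum_(i < n) (y i - b) ^+ 2 + (2 * (b - ybar) * \sum_(i < n) (y i - b) +
     n%:R * (b - ybar) ^+ 2).
  have -> : n%:R * (b - ybar) ^+ 2 = \sum_(i < n) (b - ybar) ^+ 2.
    by rewrite sumr_const card_ord mulr_natl.
  by rewrite mulr_sumr -!big_split/=; apply: eq_bigr => i _; ring.
rewrite sumrB yE sumr_const card_ord -[b *+ n]mulr_natl subrr mulr0 add0r mulrDr.
by rewrite mulKf.
Unshelve. all: by end_near. Qed.

Section InverseProbabilityWeighting.
Context {R : realType} {d : measure_display} {T : measurableType d}.
Context (P : probability T R) (G : nat -> set (set T)) (K p : nat -> T -> R).
Context (delta pstar : R).
Local Notation E f := (Rintegral P setT f).
Context (fG : filtration G).
Context (mK : forall i, gmeas (G i.+1) (K i)).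
Context (K01 : forall i w, K i w = 0 \/ K i w = 1).
Context (mp : forall i, gmeas (G i) (p i)).
Context (delta0 : 0 < delta).
Context (pb : forall i w, delta <= p i w <= 1 - delta).
Context (oK : forall i A, <<s G i >> A ->
  E (fun w => \1_A w * (K i w - p i w)) = 0).

Lemma treatment_mdiff : mdiff P G (fun i w => K i w - p i w) 1.
Proof.
split => // [i|i w]; first by apply: gmeasB; [exact: mK|exact: gmeasS (fG.2 _) (@mp i)].
have := pb i w; rewrite ler_norml.
by have d0 := delta0; case: (K01 i w) => ->; lra.
Qed.

Lemma K_bmeas i : bmeas (K i).
Proof.
split; first exact: gmeas_meas (fG.1 _) (@mK i).
by exists 1 => w; case: (K01 i w) => ->; rewrite ?normr1 ?normr0.
Qed.

Lemma p_bmeas i : bmeas (p i).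
Proof.
split; first exact: gmeas_meas (fG.1 _) (@mp i).
exists 1 => w; have := pb i w; rewrite ler_norml.
by have d0 := delta0; lra.
Qed.

Lemma weighted_mdiff_cvgL1 (h : nat -> T -> R) (B : R) :
  (forall i, gmeas (G i) (h i)) -> (forall i w, `|h i w| <= B) ->
  cvgL1 P (fun n w => n%:R^-1 * \sum_(i < n) h i w * (K i w - p i w)) 0.
Proof.
move=> mh hB; have mX := mdiff_mul fG treatment_mdiff mh hB.
split=> [n|].
  apply: bmeasM; [exact: bmeas_cst|apply: bmeas_sum => i].
  exact: (mdiff_bmeas fG mX).
by under eq_fun do under eq_fun do rewrite subr0; exact: mdiff_mean_L1 mX.
Qed.

(** * Laws of large numbers for one arm of a strongly stable design *)

Section StrongStability.
Context (pK : cvg_in_prob P p pstar).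

(** Split [K z = z (K - p) + (p - pstar) z + pstar z]: a martingale term, a Cesaro mean of L1-null
    terms, and a deterministic mean. *)
Lemma treated_mean_cvgL1 (z : nat -> R) (l B : R) :
  (forall i, `|z i| <= B) ->
  (fun n => n%:R^-1 * \sum_(i < n) z i) @ \oo --> l ->
  cvgL1 P (fun n w => n%:R^-1 * \sum_(i < n) K i w * z i) (pstar * l).
Proof.
move=> zB zl.
have pL1 : cvgL1 P p pstar.
  apply: (@cvg_in_prob_L1 _ _ _ _ _ _ 1) => // [n|n w].
    exact: (p_bmeas n).1.
  by have := pb n w; have d0 := delta0; rewrite ler_norml; lra.
have H1 : cvgL1 P (fun n w => n%:R^-1 * \sum_(i < n) z i * (K i w - p i w)) 0.
  apply: (@weighted_mdiff_cvgL1 (fun i _ => z i) B) => // i.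
  exact: gmeas_cst.
have H2 : cvgL1 P
    (fun n w => n%:R^-1 * \sum_(i < n) ((p i w - pstar) * z i - 0)) 0.
  apply: (cvgL1_mean (X := fun i w => (p i w - pstar) * z i)).
  apply: (cvgL1_dom (K := B)) pL1 => [n|n w].
    apply: bmeasM; last exact: bmeas_cst.
    by apply: bmeasB; [exact: p_bmeas|exact: bmeas_cst].
  by rewrite subr0 normrM mulrC ler_wpM2r.
have H3 : cvgL1 P (fun n _ => pstar * (n%:R^-1 * \sum_(i < n) z i)) (pstar * l).
  by apply: cvgL1_cst; exact: cvgMr.
have := cvgL1D H1 (cvgL1D H2 H3); rewrite !add0r.
congr (cvgL1 P _ _); apply/funext => n; apply/funext => w.
rewrite mulrCA -!mulrDr mulr_sumr -!big_split/=; congr (_ * _).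
by apply: eq_bigr => i _; ring.
Qed.

Context (y : nat -> R) (M ybar s2 : R).
Context (yM : forall i, `|y i| <= M).
Context (yb : barY y @ \oo --> ybar) (ys : fp_var y @ \oo --> s2).

(** The potential outcome [y j] stands for the observed one, with which it agrees whenever [K j w]
    is 1. *)
Definition ipw_mean (n : nat) (w : T) : R :=
  n%:R^-1 * \sum_(j < n) K j w * y j / p j w.

Lemma p_inv_bound i w : `|(p i w)^-1| <= delta^-1.
Proof.
have /andP[dp _] := pb i w.
have p0 : 0 < p i w by exact: lt_le_trans dp.
by rewrite ger0_norm ?invr_ge0 ?(ltW p0)// lef_pV2.
Qed.

(** As [p i] is positive, its inverse is the real power of exponent -1, a measurable function. *)
Lemma gmeas_pV i : gmeas (G i) (fun w => (p i w)^-1).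
Proof.
have -> : (fun w => (p i w)^-1) = (fun w => (p i w) `^ (-1)).
  apply/funext => w; have /andP[dp _] := pb i w.
  by rewrite powR_inv1// (le_trans _ dp)// ltW.
exact: (measurableT_comp (measurable_powR (-1)) (@mp i)).
Qed.

Lemma ipw_term_bmeas j : bmeas (fun w => K j w * y j / p j w).
Proof.
apply: bmeasM; first by apply: bmeasM; [exact: K_bmeas|exact: bmeas_cst].
split; first exact: gmeas_meas (fG.1 _) (@gmeas_pV j).
by exists delta^-1 => w; exact: p_inv_bound.
Qed.

Lemma ipw_mean_bmeas n : bmeas (ipw_mean n).
Proof.
by apply: bmeasM; [exact: bmeas_cst|apply: bmeas_sum => j; exact: ipw_term_bmeas].
Qed.

(** Uniformity in [n] and [w] is the point: it makes squared deviations Lipschitz in the running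
    mean. *)
Lemma ipw_mean_bound n w : `|ipw_mean n w| <= M / delta.
Proof.
have M0 : 0 <= M by rewrite (le_trans _ (yM 0)).
have Md : 0 <= M / delta by rewrite divr_ge0// ltW.
rewrite /ipw_mean normrM ger0_norm ?invr_ge0//.
apply: (@le_trans _ _ (n%:R^-1 * \sum_(j < n) M / delta)).
  rewrite ler_wpM2l ?invr_ge0//; apply: (le_trans (ler_norm_sum _ _ _)).
  apply: ler_sum => j _; rewrite normrM ler_pM//; last exact: p_inv_bound.
  by case: (K01 j w) => ->; rewrite ?mul1r// mul0r normr0.
rewrite sumr_const card_ord -[M / delta *+ n]mulr_natl.
have [->|n0] := eqVneq n 0%N; first by rewrite mul0r mulr0.
by rewrite mulKf// pnatr_eq0.
Qed.

(** Unbiasedness made explicit: [K y / p = (y / p) (K - p) + y], where the weight [y / p] is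
    predictable and bounded. *)
Lemma ipw_mean_cvgL1 : cvgL1 P ipw_mean ybar.
Proof.
have H1 : cvgL1 P
    (fun n w => n%:R^-1 * \sum_(i < n) (y i / p i w) * (K i w - p i w)) 0.
  apply: (@weighted_mdiff_cvgL1 (fun i w => y i / p i w) (M / delta)) => [i|i w].
    by apply: gmeasM; [exact: gmeas_cst|exact: gmeas_pV].
  by rewrite normrM ler_pM//; exact: p_inv_bound.
have := cvgL1D H1 (cvgL1_cst P yb); rewrite add0r.
congr (cvgL1 P _ _); apply/funext => n; apply/funext => w.
rewrite /barY -mulrDr -big_split/=; congr (_ * _).
apply: eq_bigr => i _; have /andP[dp _] := pb i w; field.
by rewrite gt_eqF// (lt_le_trans _ dp).
Qed.

Lemma treated_sqr_dev_cvgL1 :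
  cvgL1 P (fun n w => n%:R^-1 * \sum_(i < n) K i w * (y i - ipw_mean i w) ^+ 2)
    (pstar * s2).
Proof.
pose z i := (y i - ybar) ^+ 2.
have zB i : `|z i| <= (M + `|ybar|) ^+ 2.
  have M0 : 0 <= M by rewrite (le_trans _ (yM 0)).
  rewrite normrX; apply: lerXn2r; rewrite ?nnegrE// ?addr_ge0//.
  by rewrite (le_trans (ler_normB _ _))// lerD.
have H1 := treated_mean_cvgL1 zB (cvg_mean_sqr_dev yb ys).
(* The cost of replacing the running mean by its limit. Factored as a difference of squares, it is
   at most a constant times [|ipw_mean i w - ybar|]. *)
pose X i w := K i w * ((y i - ipw_mean i w) ^+ 2 - z i).
have bX i : bmeas (X i).
  apply: bmeasM; first exact: K_bmeas.
  apply: bmeasB; last exact: bmeas_cst.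
  under eq_fun do rewrite expr2.
  by apply: bmeasM; apply: bmeasB; (exact: bmeas_cst || exact: ipw_mean_bmeas).
have H2 : cvgL1 P (fun n w => n%:R^-1 * \sum_(i < n) (X i w - 0)) 0.
  apply: cvgL1_mean.
  (* Bounds for the two summands [y n - ipw_mean n w] and [y n - ybar] of the other factor. *)
  pose B := (M + M / delta) + (M + `|ybar|).
  apply: (cvgL1_dom (K := B)) ipw_mean_cvgL1 => // n w.
  have -> : X n w - 0 = K n w * ((y n - ipw_mean n w) + (y n - ybar)) *
      (ybar - ipw_mean n w) by rewrite /X /z; ring.
  rewrite [in leRHS]distrC normrM ler_wpM2r// normrM.
  rewrite -[leRHS]mul1r ler_pM//.
    by case: (K01 n w) => ->; rewrite ?normr1 ?normr0.
  apply: (le_trans (ler_normD _ _)); rewrite lerD//;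
    apply: (le_trans (ler_normB _ _)); rewrite lerD//.
  exact: ipw_mean_bound.
have := cvgL1D H1 H2; rewrite addr0.
congr (cvgL1 P _ _); apply/funext => n; apply/funext => w.
rewrite -mulrDr -big_split/=; congr (_ * _).
by apply: eq_bigr => i _; rewrite /X; ring.
Qed.

(** Written for generic indicators, probabilities and outcomes, so that both arms are instances. *)
Definition treated_variance (n : nat) (w : T) : R :=
  (Num.max (\sum_(i < n) K i w) 1)^-1 *
  \sum_(i < n) K i w * (y i - ipw_mean i w) ^+ 2.

(** A quotient of two convergent means, with limit [pstar * s2 / pstar]. Measurability is included
    for the later continuous mapping step. *)
Lemma treated_variance_cvg : 0 < pstar ->
  (forall n, measurable_fun setT (treated_variance n)) /\
  cvg_in_prob P treated_variance s2.
Proof.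
move=> p0.
have bterm i : bmeas (fun w => K i w * (y i - ipw_mean i w) ^+ 2).
  under eq_fun do rewrite expr2.
  apply: bmeasM; first exact: K_bmeas.
  by apply: bmeasM; apply: bmeasB; (exact: bmeas_cst || exact: ipw_mean_bmeas).
have bS n : bmeas (fun w => \sum_(i < n) K i w) by apply: bmeas_sum => i; exact: K_bmeas.
have mZ n : measurable_fun setT (treated_variance n).
  have m1 : measurable_fun setT (fun w => Num.max (\sum_(i < n) K i w) 1 : R).
    by apply: measurable_maxr => //; exact: (bS n).1.
  have -> : treated_variance n = (fun w => (Num.max (\sum_(i < n) K i w) 1) `^ (-1) *
      \sum_(i < n) K i w * (y i - ipw_mean i w) ^+ 2).
    by apply/funext => w; rewrite powR_inv1// le_max ler01 orbT.
  apply: measurable_funM; last by apply: (bmeas_sum _ _).1 => i.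
  exact: (measurableT_comp (measurable_powR (-1)) m1).
split => //.
have H1 : cvgL1 P (fun n w => n%:R^-1 * \sum_(i < n) K i w * 1) (pstar * 1).
  apply: (@treated_mean_cvgL1 (fun=> 1) _ 1) => [i|]; first by rewrite normr1.
  exact: (@cvg_mean R (fun=> 1) 1 (cvg_cst _)).
have H2 := treated_sqr_dev_cvgL1.
pose f (x : R * R) := x.1^-1 * x.2.
have -> : s2 = f (pstar * 1, pstar * s2) by rewrite /f/= mulr1 mulKf// gt_eqF.
(* Within [pstar / 2] of the limit the treated fraction is at least [pstar / 2]; once
   [n >= 2 / pstar] the treated count is at least 1 and the truncation by [Num.max] is inactive. *)
apply: (@cvg_in_prob_map2 _ _ _ _ _ _ _ _ _ _ (pstar / 2)) (cvgL1_prob H1)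
    (cvgL1_prob H2) => //.
- by move=> n; exact: (H1.1 n).1.
- by move=> n; exact: (H2.1 n).1.
- apply: cvgM; last exact: cvg_snd.
  by apply: cvgV; [rewrite mulr1 gt_eqF|exact: cvg_fst].
- by rewrite divr_gt0.
near=> n => w; rewrite /f/= mulr1.
under eq_bigr do rewrite mulr1.
have n0 : 0 < n%:R :> R by rewrite ltr0n; near: n; exact: nbhs_infty_gt.
have n2 : 2 / pstar <= n%:R by near: n; exact: nbhs_infty_ger.
rewrite /treated_variance; set S := \sum_(i < n) K i w => Sp.
have S1 : 1 <= S.
  have : pstar / 2 <= n%:R^-1 * S by move: Sp; rewrite ler_norml; lra.
  rewrite ler_pdivlMl//; apply: le_trans.
  by rewrite mulrA ler_pdivlMr// mul1r -ler_pdivrMr.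
rewrite max_l// invfM invrK -mulrA [_ * (_ * \sum_(_ < _) _)]mulrCA mulVKf//.
by rewrite gt_eqF.
Unshelve. all: by end_near. Qed.

End StrongStability.
End InverseProbabilityWeighting.

(** * The sequential design *)

Section SequentialDesign.
Context {R : realType} {d : measure_display} {T : measurableType d}.
Context (P : probability T R) (K p : nat -> T -> R) (Y0 Y1 : nat -> R).
Local Notation E f := (Rintegral P setT f).
Context (mK : forall i, measurable_fun setT (K i)).
Context (K01 : forall i w, K i w = 0 \/ K i w = 1).

(** The generators of [hist], isolated because [gmeas] and [filtration] take generating families. *)
Definition hist_gen (i : nat) : set (set T) :=
  [set A | exists j, (j < i)%N /\ exists B : set R, measurable B /\
     (A = K j @^-1` B \/ A = Yobs K Y0 Y1 j @^-1` B)].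

Lemma measurable_Yobs i : measurable_fun setT (Yobs K Y0 Y1 i).
Proof.
apply: measurable_funD; apply: measurable_funM => //.
exact: measurable_funB.
Qed.

Lemma hist_filtration : filtration hist_gen.
Proof.
split=> i.
  apply: smallest_sub; first exact: sigma_algebra_measurable.
  move=> A [j [_ [B [mB [] ->]]]]; rewrite -[_ @^-1` _]setTI.
    exact: mK.
  exact: measurable_Yobs.
apply: sub_sigma_algebra2 => A [j [ji AB]]; exists j; split => //.
by rewrite ltnS ltnW.
Qed.

Lemma gmeas_K i : gmeas (hist_gen i.+1) (K i).
Proof.
move=> _ B mB; rewrite setTI; apply: sub_sigma_algebra.
by exists i; split => //; exists B; split => //; left.
Qed.

Lemma gmeas_hist (i : nat) (f : T -> R) :
  (forall B : set R, measurable B -> hist K Y0 Y1 i (f @^-1` B)) ->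
  gmeas (hist_gen i) f.
Proof. by move=> hf _ B mB; rewrite setTI; exact: hf. Qed.

(** As [K i] is 0 or 1, [\1_A * K i] is the indicator of a set whose probability the design
    condition gives as the integral of [p i] over [A]. *)
Lemma treatment_orthogonal i (A : set T) (delta : R) :
  0 < delta -> (forall w, delta <= p i w <= 1 - delta) ->
  (forall B : set R, measurable B -> hist K Y0 Y1 i (p i @^-1` B)) ->
  (P (A `&` [set w | K i w = 1%R]) = \int[P]_(w in A) (p i w)%:E)%E ->
  hist K Y0 Y1 i A -> E (fun w => \1_A w * (K i w - p i w)) = 0.
Proof.
move=> d0 pb hp PA hA.
have mA : measurable A by exact: (hist_filtration.1 i).
have bA : bmeas (\1_A : T -> R) by exact: bmeas_indic.
have bp : bmeas (p i).
  split; first exact: gmeas_meas (hist_filtration.1 i) (gmeas_hist hp).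
  by exists 1 => w; have := pb w; rewrite ler_norml; lra.
have bK : bmeas (K i).
  split; first exact: mK.
  by exists 1 => w; case: (K01 i w) => ->; rewrite ?normr1 ?normr0.
under eq_fun do rewrite mulrBr.
rewrite E_B; [|exact: bmeasM|exact: bmeasM].
have mAK : measurable (A `&` [set w | K i w = 1]).
  apply: measurableI => //.
  have := mK i measurableT (measurable_set1 1).
  by rewrite setTI.
have -> : (fun w => \1_A w * K i w) = \1_(A `&` [set w | K i w = 1]).
  apply/funext => w; rewrite indicI; congr (_ * _); rewrite indicE.
  case: (K01 i w) => Kw; rewrite Kw.
    by rewrite memNset//= Kw => /esym/eqP; rewrite oner_eq0.
  by rewrite mem_set.
have -> : (fun w => \1_A w * p i w) = p i \_ A.
  apply/funext => w; rewrite patchE indicE.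
  by case: ifP => _; rewrite ?mul1r ?mul0r.
rewrite -Rintegral_mkcond; apply/eqP; rewrite subr_eq0; apply/eqP.
by have := E_indic (P := P) mAK; rewrite PA => H; rewrite /(\int[P]_(w in A) _) -H.
Qed.

End SequentialDesign.

(** * Cauchy-Schwarz for limiting finite-population moments, and its equality case *)

Section FinitePopulation.
Context {R : realType}.

Lemma fp_cov_limit_le (Y0 Y1 : nat -> R) (v0 v1 c : R) : 0 < v0 -> 0 < v1 ->
  fp_var Y0 @ \oo --> v0 -> fp_var Y1 @ \oo --> v1 ->
  fp_cov Y0 Y1 @ \oo --> c -> c <= Num.sqrt v0 * Num.sqrt v1.
Proof.
move=> v00 v10 h0 h1 hc.
set s := Num.sqrt v0; set t := Num.sqrt v1.
have s0 : 0 < s by rewrite sqrtr_gt0.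
have t0 : 0 < t by rewrite sqrtr_gt0.
have sE : s ^+ 2 = v0 by rewrite sqr_sqrtr// ltW.
have tE : t ^+ 2 = v1 by rewrite sqr_sqrtr// ltW.
(* the limit of the nonnegative forms [mean ((t a_i - s b_i)^2)] *)
have H : (fun n => t ^+ 2 * fp_var Y0 n + s ^+ 2 * fp_var Y1 n -
    2 * s * t * fp_cov Y0 Y1 n) @ \oo --> t ^+ 2 * v0 + s ^+ 2 * v1 - 2 * s * t * c.
  by apply: cvgB; [apply: cvgD|]; exact: cvgMr.
have : 0 <= t ^+ 2 * v0 + s ^+ 2 * v1 - 2 * s * t * c.
  apply: (cvgr_to_ge H); apply: nearW => n.
  rewrite /fp_var /fp_cov !(mulrCA _ n%:R^-1) -mulrDr -mulrBr.
  rewrite mulr_ge0 ?invr_ge0// !mulr_sumr -big_split -sumrB/=.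
  rewrite sumr_ge0// => i _; set x := _ - barY Y0 n; set y := _ - barY Y1 n.
  have -> : t ^+ 2 * x ^+ 2 + s ^+ 2 * y ^+ 2 - 2 * s * t * (x * y) =
    (t * x - s * y) ^+ 2 by ring.
  exact: sqr_ge0.
(* The weights [t] and [s] were chosen so that the limiting form factors as [2 s t (s t - c)] with
   [2 s t] positive. *)
rewrite -sE -tE.
have -> : t ^+ 2 * s ^+ 2 + s ^+ 2 * t ^+ 2 - 2 * s * t * c =
  (2 * s * t) * (s * t - c) by ring.
by rewrite pmulr_rge0 ?mulr_gt0// subr_ge0.
Qed.

(** Equality in Cauchy-Schwarz holds for each [N] and passes to the limit. The factor [k] may vary
    with [N]; its sign selects the positive root. *)
Lemma fp_cov_limit_homogeneous (Y0 Y1 : nat -> R) (v0 v1 c : R) :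
  0 < v0 -> 0 < v1 ->
  fp_var Y0 @ \oo --> v0 -> fp_var Y1 @ \oo --> v1 ->
  fp_cov Y0 Y1 @ \oo --> c ->
  (forall N : nat, exists k : R, 0 <= k /\ forall i : nat, (i < N)%N ->
     Y1 i - barY Y1 N = k * (Y0 i - barY Y0 N)) ->
  c = Num.sqrt v0 * Num.sqrt v1.
Proof.
move=> v00 v10 h0 h1 hc hom.
have covE n : fp_cov Y0 Y1 n = Num.sqrt (fp_var Y0 n * fp_var Y1 n).
  have [k [k0 kE]] := hom n.
  have var0 : 0 <= fp_var Y0 n.
    by rewrite mulr_ge0 ?invr_ge0// sumr_ge0// => i _; exact: sqr_ge0.
  have -> : fp_cov Y0 Y1 n = k * fp_var Y0 n.
    rewrite /fp_cov /fp_var mulrCA [in RHS]mulr_sumr; congr (_ * _).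
    by apply: eq_bigr => i _; rewrite kE//; ring.
  have -> : fp_var Y1 n = k ^+ 2 * fp_var Y0 n.
    rewrite /fp_var mulrCA [in RHS]mulr_sumr; congr (_ * _).
    by apply: eq_bigr => i _; rewrite kE//; ring.
  have -> : fp_var Y0 n * (k ^+ 2 * fp_var Y0 n) = (k * fp_var Y0 n) ^+ 2 by ring.
  by rewrite sqrtr_sqr ger0_norm// mulr_ge0.
rewrite -sqrtrM; last exact: ltW.
have H : fp_cov Y0 Y1 @ \oo --> Num.sqrt (v0 * v1).
  have -> : fp_cov Y0 Y1 = Num.sqrt \o (fun n => fp_var Y0 n * fp_var Y1 n).
    exact/funext.
  apply: continuous_cvg; first exact: sqrt_continuous.
  exact: cvgM.
exact: (cvg_unique _ hc H).
Qed.

End FinitePopulation.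

(** * Assembly of the two arms and comparison of the limits *)

Theorem theorem5 (R : realType) (d : measure_display) (T : measurableType d)
  (P : probability T R) (Y0 Y1 : nat -> R) (K p : nat -> T -> R)
  (pstar delta M Ybar0 Ybar1 s0sq s1sq s01 : R) :
  (* treatment indicators: {0,1}-valued random variables *)
  (forall i, measurable_fun setT (K i)) ->
  (forall i w, K i w = 0 \/ K i w = 1) ->
  (* sequential design: p_i is F_{i-1}-measurable and P(K_i = 1 | F_{i-1}) = p_i *)
  (forall i (B : set R), measurable B -> hist K Y0 Y1 i (p i @^-1` B)) ->
  (forall i (A : set T), hist K Y0 Y1 i A ->
     (P (A `&` [set w | K i w = 1%R]) = \int[P]_(w in A) (p i w)%:E)%E) ->
  (* strong design stability *)
  0 < pstar < 1 -> cvg_in_prob P p pstar ->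
  (* Assumption B *)
  0 < delta < 1 -> (forall i w, delta <= p i w <= 1 - delta) ->
  0 < M -> (forall i, `|Y0 i| <= M /\ `|Y1 i| <= M) ->
  barY Y0 @ \oo --> Ybar0 -> barY Y1 @ \oo --> Ybar1 ->
  fp_var Y0 @ \oo --> s0sq -> fp_var Y1 @ \oo --> s1sq ->
  fp_cov Y0 Y1 @ \oo --> s01 ->
  0 < s0sq -> 0 < s1sq ->
  let a := Num.sqrt (pstar / (1 - pstar)) in
  let b := Num.sqrt ((1 - pstar) / pstar) in
  let Vlim := (Num.sqrt s0sq * a + Num.sqrt s1sq * b) ^+ 2 in
  let V := s0sq * (pstar / (1 - pstar)) + s1sq * ((1 - pstar) / pstar) + 2 * s01 in
  [/\ cvg_in_prob P (sig0hat2 K p Y0 Y1) s0sq,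
      cvg_in_prob P (sig1hat2 K p Y0 Y1) s1sq,
      cvg_in_prob P (Vhat_strong K p Y0 Y1 pstar) Vlim,
      V <= Vlim &
      ((forall N : nat, exists c : R, 0 <= c /\ forall i : nat, (i < N)%N ->
          Y1 i - barY Y1 N = c * (Y0 i - barY Y0 N)) ->
       cvg_in_prob P (Vhat_strong K p Y0 Y1 pstar) V)].
Proof.
move=> mK K01 hp PK /andP[p0 p1] pp /andP[d0 d1] pb M0 YM yb0 yb1 ys0 ys1 yc.
move=> s0 s1 a b Vlim V.
have q0 : 0 < 1 - pstar by rewrite subr_gt0.
have fG := hist_filtration Y0 Y1 mK.
have mKG i : gmeas (hist_gen K Y0 Y1 i.+1) (K i) by exact: gmeas_K.
have mp i : gmeas (hist_gen K Y0 Y1 i) (p i) by exact: (gmeas_hist (hp i)).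
have oK i A : <<s hist_gen K Y0 Y1 i >> A ->
    \int[P]_w (\1_A w * (K i w - p i w)) = 0.
  by move=> GA; exact: (treatment_orthogonal mK K01 d0 (pb i) (hp i) (PK i A GA) GA).
have [m1 c1] : (forall n, measurable_fun setT (sig1hat2 K p Y0 Y1 n)) /\
    cvg_in_prob P (sig1hat2 K p Y0 Y1) s1sq.
  have := treated_variance_cvg fG mKG K01 mp d0 pb oK pp
    (fun i => (YM i).2) yb1 ys1 p0.
  set Z := treated_variance _ _ _; suff -> : Z = sig1hat2 K p Y0 Y1 by [].
  apply/funext => n; apply/funext => w; rewrite /Z /treated_variance /sig1hat2 /N1; congr (_ * _).
  apply: eq_bigr => i _.
  have -> : Yhat1 K p Y0 Y1 i w = ipw_mean K p Y1 i w.
    rewrite /Yhat1 /ipw_mean; congr (_ * _); apply: eq_bigr => j _.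
    by rewrite /Yobs; case: (K01 j w) => ->; rewrite ?mul0r// subrr mul0r addr0 !mul1r.
  by rewrite /Yobs; case: (K01 i w) => ->; rewrite ?mul0r// subrr mul0r addr0 !mul1r.
have [m0 c0] : (forall n, measurable_fun setT (sig0hat2 K p Y0 Y1 n)) /\
    cvg_in_prob P (sig0hat2 K p Y0 Y1) s0sq.
  (* The control arm is the treated arm of the flipped design, adapted to the same filtration; the
     bounds by [delta] are symmetric under the flip. *)
  pose L i w := 1 - K i w; pose q i w := 1 - p i w.
  have mL i : gmeas (hist_gen K Y0 Y1 i.+1) (L i).
    by apply: gmeasB; [exact: gmeas_cst|exact: mKG].
  have mq i : gmeas (hist_gen K Y0 Y1 i) (q i).
    by apply: gmeasB; [exact: gmeas_cst|exact: mp].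
  have L01 i w : L i w = 0 \/ L i w = 1.
    by rewrite /L; case: (K01 i w) => ->; [right|left]; rewrite ?subr0 ?subrr.
  have qb i w : delta <= q i w <= 1 - delta by have := pb i w; rewrite /q; lra.
  have oL i A : <<s hist_gen K Y0 Y1 i >> A ->
      \int[P]_w (\1_A w * (L i w - q i w)) = 0.
    move=> GA; have -> : (fun w => \1_A w * (L i w - q i w)) =
        (fun w => (-1) * (\1_A w * (K i w - p i w))).
      by apply/funext => w; rewrite /L /q; ring.
    rewrite E_Z ?oK ?mulr0//.
    apply: bmeasM; first by apply: bmeas_indic; exact: (fG.1 i A GA).
    apply: bmeasB; first exact: (K_bmeas fG mKG K01).
    exact: (p_bmeas fG mp d0 pb).
  have qq : cvg_in_prob P q (1 - pstar).
    move=> eps e0; have dev n w : `|q n w - (1 - pstar)| = `|p n w - pstar|.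
      by rewrite distrC /q; congr `|_|; ring.
    under eq_fun do under eq_set do rewrite dev.
    exact: pp.
  have := treated_variance_cvg fG mL L01 mq d0 qb oL qq
    (fun i => (YM i).1) yb0 ys0 q0.
  set Z := treated_variance _ _ _; suff -> : Z = sig0hat2 K p Y0 Y1 by [].
  apply/funext => n; apply/funext => w; rewrite /Z /treated_variance /sig0hat2 /N0 /N1.
  congr ((Num.max _ _)^-1 * _).
    by rewrite /L sumrB sumr_const card_ord.
  apply: eq_bigr => i _.
  have -> : Yhat0 K p Y0 Y1 i w = ipw_mean L q Y0 i w.
    rewrite /Yhat0 /ipw_mean; congr (_ * _); apply: eq_bigr => j _.
    rewrite /Yobs /L /q; case: (K01 j w) => ->; last by rewrite subrr !mul0r.
    by rewrite subr0 mul0r add0r !mul1r.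
  rewrite /Yobs /L; case: (K01 i w) => ->; last by rewrite subrr !mul0r.
  by rewrite subr0 mul0r add0r !mul1r.
have cV : cvg_in_prob P (Vhat_strong K p Y0 Y1 pstar) Vlim.
  pose f (x : R * R) := (Num.sqrt x.1 * a + Num.sqrt x.2 * b) ^+ 2.
  have msqrt (X : T -> R) : measurable_fun setT X ->
      measurable_fun setT (fun w => Num.sqrt (X w)).
    move=> mX; apply: measurableT_comp mX.
    by apply: continuous_measurable_fun; exact: sqrt_continuous.
  (* The radius 1 is arbitrary, since here the identity with [f] holds everywhere. *)
  apply: (@cvg_in_prob_map2 _ _ _ _ _ _ _ f s0sq s1sq 1) c0 c1 => //.
  - move=> n; apply: measurable_funX; apply: measurable_funD;
      apply: measurable_funM => //; exact: msqrt.
  - have h : (fun x : R * R => Num.sqrt x.1 * a + Num.sqrt x.2 * b) @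
        nbhs (s0sq, s1sq) --> Num.sqrt s0sq * a + Num.sqrt s1sq * b.
      apply: cvgD; apply: cvgMl; apply: continuous_cvg.
      + exact: sqrt_continuous.
      + exact: cvg_fst.
      + exact: sqrt_continuous.
      + exact: cvg_snd.
    exact: (cvgM h h).
  - exact: nearW.
have r0 : 0 < pstar / (1 - pstar) by rewrite divr_gt0.
have r1 : 0 < (1 - pstar) / pstar by rewrite divr_gt0.
have ab : a * b = 1.
  rewrite /a /b -sqrtrM ?ltW// (_ : _ * _ = 1) ?sqrtr1//.
  by field; rewrite !gt_eqF.
(* Because [a * b = 1], the two limits differ only in their cross terms; the gap is the
   Cauchy-Schwarz defect, nonnegative in general and zero under homogeneity. *)
have VE : Vlim - V = 2 * (Num.sqrt s0sq * Num.sqrt s1sq - s01).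
  have -> : Vlim = Num.sqrt s0sq ^+ 2 * a ^+ 2 + Num.sqrt s1sq ^+ 2 * b ^+ 2 +
      2 * (Num.sqrt s0sq * Num.sqrt s1sq) * (a * b) by rewrite /Vlim; ring.
  by rewrite ab /a /b !sqr_sqrtr ?ltW// /V; ring.
split => //.
- rewrite -subr_ge0 VE mulr_ge0// subr_ge0.
  exact: fp_cov_limit_le ys0 ys1 yc.
- move=> hom; suff -> : V = Vlim by [].
  apply/esym/eqP; rewrite -subr_eq0 VE.
  by rewrite (fp_cov_limit_homogeneous s0 s1 ys0 ys1 yc hom) subrr mulr0.
Qed.
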